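(* Let $S^n_{\ell;d;(n_1,\ldots,n_\ell)}$ be the coefficients defined in the context. For every $n\ge0$ and every list of parameters $\ell;d;(n_1,\ldots,n_\ell)$ admissible for $n+1$, the coefficient $S^{n+1}_{\ell;d;(n_1,\ldots,n_\ell)}$ can be calculated by means of the recurrent relations $$S^{n+1}_{\ell;d;(n_1,\ldots,n_\ell)}=\bigl(1+(-1)^n\bigr)S^n_{\ell;d-1;(n_1,\ldots,n_\ell)}+\sum_{n_k\in\{n_1,\ldots,n_\ell\}}\binom{d+n_k}{n_k}S^n_{\ell-1;d+n_k+1;(n_1,\ldots,n_{k-1},n_{k+1},\ldots,n_\ell)}\quad\text{if }d=1,$$ $$S^{n+1}_{\ell;d;(n_1,\ldots,n_\ell)}=S^n_{\ell;d-1;(n_1,\ldots,n_\ell)}+\sum_{n_k\in\{n_1,\ldots,n_\ell\}}\binom{d+n_k}{n_k}S^n_{\ell-1;d+n_k+1;(n_1,\ldots,n_{k-1},n_{k+1},\ldots,n_\ell)}\quad\text{if }d\ne1,$$ where $\sum_{n_k\in\{n_1,\ldots,n_\ell\}}$ means that only different values among the $n_i$ are used in the sum (each distinct value once), with the initial conditions $$S^0_{0;0;()}=\tfrac12,\qquad S^n_{0;n;()}=1\quad\text{for }n\ge1.$$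
   Context: A list $\ell;d;(n_1,\ldots,n_\ell)$ of non-negative integers is admissible for $n$ if $0\le\ell\le\frac n2$, $0\le d\le n-2\ell$, $0\le n_1\le n_2\le\ldots\le n_\ell$ and $n_1+\ldots+n_\ell+2\ell+d=n$. The coefficients $S^n_{\ell;d;(n_1,\ldots,n_\ell)}$ arise from rewriting $(\partial_u-\partial_v)^n\mathbf{H}$ for a (formal, smooth) solution $\mathbf{H}(u,v)$ of $\partial_u\partial_v\mathbf{H}=q(u+v)\mathbf{H}$, as follows. Let $E^n_d$ stand for the expression $\bigl(\partial_u^d+(-1)^n\partial_v^d\bigr)\mathbf{H}(u,v)$, with $\partial_u^0=\partial_v^0$ the identity; $E^n_d$ is treated as a formal symbol (also when $d=0$ and $n$ is odd, where its value is $0$). Start with $\mathbf{H}=\frac12E^0_0$. Given the representation of $(\partial_u-\partial_v)^n\mathbf{H}$ as a linear combination of terms $E^n_d\prod_{i=1}^\ell q^{(n_i)}(u+v)$, apply $\partial_u-\partial_v$ to each term, using the Leibniz rule, $(\partial_u-\partial_v)q^{(k)}(u+v)=0$ and $\partial_u\partial_v\mathbf{H}=q(u+v)\mathbf{H}$; that is, $$E^n_0\prod_{i=1}^\ell q^{(n_i)}\longmapsto\bigl(1+(-1)^n\bigr)E^{n+1}_1\prod_{i=1}^\ell q^{(n_i)},$$ $$E^n_d\prod_{i=1}^\ell q^{(n_i)}\longmapsto E^{n+1}_{d+1}\prod_{i=1}^\ell q^{(n_i)}-\sum_{k=0}^{d-1}\binom{d-1}kq^{(k)}E^{n+1}_{d-1-k}\prod_{i=1}^\ell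 q^{(n_i)}\qquad(d\ge1),$$ where $q^{(k)}$ means $q^{(k)}(u+v)$. In the resulting representation of $(\partial_u-\partial_v)^n\mathbf{H}$, after collecting like terms (factors $q^{(n_i)}$ commute and are listed with $n_1\le\ldots\le n_\ell$), the coefficient of $E^n_d\prod_{i=1}^\ell q^{(n_i)}(u+v)$ is denoted $(-1)^\ell S^n_{\ell;d;(n_1,\ldots,n_\ell)}$. By convention $S^n_{\ell;d;(n_1,\ldots,n_\ell)}=0$ whenever the list is not admissible for $n$. *)

(* Defs.v *)
From mathcomp Require Import all_boot all_order all_algebra.
From mathcomp Require Import finmap multiset.
From mathcomp Require Import monalg.

Set Implicit Arguments.
Unset Strict Implicit.
Unset Printing Implicit Defensive.

Import GRing.Theory Num.Theory.

Local Open Scope ring_scope.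
Local Open Scope mset_scope.

(* The symbol (d, [mset n_1; ...; n_l]) stands for the term
   E^n_d * q^(n_1) * ... * q^(n_l).  The upper index n of E^n_d is not stored:
   it is the same for all terms of the representation of (d_u - d_v)^n H. *)
Definition term : choiceType := (nat * {mset nat})%type.

(* Formal linear combinations of terms, i.e. the free Q-module on [term];
   like terms are collected because the q-factors form a multiset. *)
Definition expr := {malg rat[term]}.

(* The image under d_u - d_v of the term (d, m) at stage n. *)
Definition diff_term (n : nat) (t : term) : expr :=
  let: (d, m) := t in
  if d is d'.+1 then
    << ((d.+1, m) : term) >>
    - \sum_(k < d) << ('C(d', k)%:R : rat) *g ((d' - k)%N, nat_of_ord k +` m) >>
  else << (1 + (-1) ^+ n : rat) *g (1%N, m) >>.

Definition diff_expr (n : nat) (e : expr) : expr :=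
  \sum_(t <- msupp e) e@_t *: diff_term n t.

(* The representation of (d_u - d_v)^n H, starting from H = 1/2 E^0_0. *)
Fixpoint representation (n : nat) : expr :=
  if n is n'.+1 then diff_expr n' (representation n')
  else << (1 / 2 : rat) *g (0%N, mset0) >>.

(* d is an integer so that the index d - 1 with d = 0 makes sense;
   such lists are not admissible. *)
Definition admissible (n l : nat) (d : int) (ns : seq nat) : bool :=
  [&& size ns == l, (2 * l <= n)%N, 0 <= d <= n%:Z - (2 * l)%:Z,
      sorted leq ns & (sumn ns + 2 * l)%:Z + d == n%:Z].

Definition Scoef (n l : nat) (d : int) (ns : seq nat) : rat :=
  if admissible n l d ns then (-1) ^+ l * (representation n)@_(`|d|%N, seq_mset ns)
  else 0.

(* Main.v *)
Require Import Defs.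
From mathcomp Require Import all_boot all_order all_algebra.
From mathcomp Require Import finmap multiset monalg.
From mathcomp Require Import zify.

(** The recurrence is the rewriting rule read backwards: it is proved at the
    level of formal expressions, by asking which terms of (d_u - d_v)^n H can
    produce E_d q^(n_1) ... q^(n_l) in one step.  There are two sources.

    The derivative part of the rule only raises the index of E, so it
    contributes from (d - 1; n_1, ..., n_l), with weight 1 + (-1)^n if d = 1
    and 1 otherwise.  The part coming from d_u d_v H = q H turns E_D into
    q^(k) E_(D-1-k) with factor - 'C(D-1, k); its k-th summand hits the target
    exactly when k is one of the n_i and the source is (d + k + 1; the list
    with one copy of k removed), and then the factor is - 'C(d + k, k).
    Because the q-factors form a multiset, equal entries n_i give one and the
    same source, whence the sum over distinct values.

    [mcoeff_diff_term] is this statement for one source term, and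
    [mcoeff_diff_expr] extends it to all expressions by linearity.  The sign
    (-1)^l in S absorbs the minus sign, since the second source has one
    q-factor less.  Finally the lists on the right-hand side are admissible for
    n whenever the one on the left is admissible for n + 1, apart from the
    index d - 1 when d = 0, so the coefficients S^n there are genuine
    coefficients of the representation. *)

Set Implicit Arguments.
Unset Strict Implicit.
Unset Printing Implicit Defensive.

Import GRing.Theory Num.Theory.

Local Open Scope ring_scope.
Local Open Scope mset_scope.

(** * Removing an entry from a multiset *)

Lemma seq_mset_rem (T : choiceType) (k : T) (s : seq T) :
  seq_mset (rem k s) = seq_mset s `\ k.
Proof.
apply/msetP => x; rewrite msetB1E !mset_seqE count_rem /= [k == x]eq_sym.
have [ks | /count_memPn ks0] := boolP (k \in s); first by [].
by case: eqP => [-> | _]; rewrite ?ks0 ?subn0.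
Qed.

Lemma mset1D_eq_seq_mset (T : choiceType) (k : T) (m : {mset T}) (s : seq T) :
  (k +` m == seq_mset s) = (k \in s) && (m == seq_mset (rem k s)).
Proof.
have in_s : (k \in seq_mset s) = (k \in s).
  by rewrite in_mset mset_seqE -has_count has_pred1.
rewrite seq_mset_rem; apply/eqP/andP => [def_s | [ks /eqP ->]].
  by rewrite -in_s -def_s mset1D1 msetD1K eqxx.
by rewrite msetB1K // in_s.
Qed.

Lemma seq_mset_nil (T : choiceType) : seq_mset [::] = mset0 :> {mset T}.
Proof. by apply/msetP => x; rewrite mset_seqE mset0E. Qed.

(** * The rewriting rule, read backwards *)

(** The factor with which one step turns [E_d] into [E_(d+1)]; for [d = 0] the
    two derivatives of [H] merge into one multiple of [E_1]. *)
Definition raise_weight (n d : nat) : rat :=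
  if d is 0 then 1 + (-1) ^+ n else 1.

(** The sum in the rule runs over the orders [k] of the new factor, the one below
    over the factors present in the target.  They agree because the indices
    [D] and [d] determine [k = D - 1 - d], so each has at most one nonzero
    summand. *)
Lemma mcoeff_diff_term (n D d : nat) (m : {mset nat}) (s : seq nat) :
  (diff_term n (D, m))@_(d, seq_mset s)
  = (if d is d'.+1 then raise_weight n d' *+ ((D, m) == (d', seq_mset s)) else 0)
    - \sum_(k <- undup s)
        'C(d + k, k)%:R *+ ((D, m) == ((d + k + 1)%N, seq_mset (rem k s))).
Proof.
case: D => [|D].
  rewrite /= mcoeffU [X in _ - X]big1_seq ?subr0; last first.
    by move=> k _; rewrite xpair_eqE addn1.
  case: d => [|[|d]] //=; rewrite !xpair_eqE //=.
rewrite /= mcoeffB mcoeffU raddf_sum /=; congr (_ - _).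
  case: d => [|d]; first by rewrite xpair_eqE.
  rewrite !xpair_eqE !eqSS; case: eqP => [<-|_] //=.
under eq_bigr => k _ do rewrite mcoeffU xpair_eqE mset1D_eq_seq_mset.
under [RHS]eq_bigr => k _ do rewrite xpair_eqE addn1 eqSS.
have [le_dD | lt_Dd] := leqP d D; last first.
  rewrite big1 => [|k _]; last by rewrite (_ : (_ == d) = false) //; lia.
  by rewrite big1 // => k _; rewrite (_ : (_ == _) = false) //; lia.
(* Here D is the predecessor of the source index, so the only k is D - d. *)
have lt_kD : (D - d < D.+1)%N by lia.
rewrite (bigD1 (Ordinal lt_kD)) //= big1 ?addr0; last first.
  move=> k /eqP ne_k; rewrite (_ : (_ == d) = false) //; apply/eqP => eq_d.
  by apply: ne_k; apply: val_inj => /=; have := ltn_ord k; lia.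
have -> : (D - (D - d) == d)%N by apply/eqP; lia.
have [ks | ks] /= := boolP ((D - d)%N \in s).
  rewrite (bigD1_seq (D - d)%N) ?undup_uniq ?mem_undup //= big1 ?addr0.
    by rewrite subnKC // eqxx.
  by move=> k /eqP ne_k; rewrite (_ : (_ == _) = false) //; lia.
rewrite big1_seq // => k /=; rewrite mem_undup => ks'.
case: eqP => // eq_D; case/negP: ks.
by rewrite (_ : (D - d = k)%N) //; lia.
Qed.

Lemma sum_msupp_delta (K : choiceType) (e : {malg rat[K]}) (t : K) (c : rat) :
  \sum_(u <- msupp e) e@_u * (c *+ (u == t)) = c * e@_t.
Proof.
have [te | te] := boolP (t \in msupp e).
  rewrite (bigD1_seq t) //= eqxx big1 ?addr0 1?mulrC // => u /negPf ->.
  by rewrite mulr0.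
rewrite (mcoeff_outdom te) mulr0 big1_seq // => u /= ue.
have /negPf -> : u != t by apply: contraNneq te => <-.
by rewrite mulr0.
Qed.

Lemma mcoeff_diff_expr (n d : nat) (s : seq nat) (e : expr) :
  (diff_expr n e)@_(d, seq_mset s)
  = (if d is d'.+1 then raise_weight n d' * e@_(d', seq_mset s) else 0)
    - \sum_(k <- undup s)
        'C(d + k, k)%:R * e@_((d + k + 1)%N, seq_mset (rem k s)).
Proof.
rewrite /diff_expr raddf_sum /=.
under eq_bigr => t _ do rewrite mcoeffZ [t]surjective_pairing mcoeff_diff_term
  mulrBr -surjective_pairing.
rewrite big_split sumrN /=; congr (_ - _).
  case: d => [|d]; last by rewrite -sum_msupp_delta.
  by rewrite big1 // => t _; rewrite mulr0.
under [RHS]eq_bigr => k _ do rewrite -sum_msupp_delta.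
by rewrite exchange_big; apply: eq_bigr => t _; rewrite mulr_sumr.
Qed.

(** * From expressions to the coefficients S *)

Lemma admissible_lower (n l d : nat) (ns : seq nat) :
  admissible n.+1 l d.+1%:Z ns -> admissible n l d%:Z ns.
Proof. by case/and5P=> sz h1 h2 h3 h4; apply/and5P; split=> //; lia. Qed.

Lemma admissible_rem (n l d k : nat) (ns : seq nat) : k \in ns ->
  admissible n.+1 l d%:Z ns ->
  (0 < l)%N /\ admissible n l.-1 (d + k + 1)%N%:Z (rem k ns).
Proof.
move=> kns /and5P[/eqP sz h1 h2 h3 h4].
have sum_rem : sumn ns = (k + sumn (rem k ns))%N.
  by rewrite (perm_sumn (perm_to_rem kns)).
have l_gt0 : (0 < l)%N by rewrite -sz; case: (ns) kns.
split=> //; apply/and5P; split; rewrite ?size_rem ?sz //; try lia.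
exact: (subseq_sorted leq_trans (rem_subseq k ns)).
Qed.

Lemma ScoefS (n l d : nat) (ns : seq nat) : admissible n.+1 l d%:Z ns ->
  Scoef n.+1 l d%:Z ns =
    (if d is d'.+1 then raise_weight n d' * Scoef n l d'%:Z ns else 0)
    + \sum_(k <- undup ns)
        'C(d + k, k)%:R * Scoef n l.-1 (d + k + 1)%N%:Z (rem k ns).
Proof.
move=> adm; rewrite {1}/Scoef adm /= mcoeff_diff_expr mulrBr -mulrN -sumrN.
congr (_ + _).
  case: d adm => [|d] adm; first by rewrite mulr0.
  by rewrite /Scoef (admissible_lower adm) mulrCA.
rewrite mulr_sumr; apply: eq_big_seq => k; rewrite mem_undup => kns.
have [l_gt0 adm'] := admissible_rem kns adm.
rewrite /Scoef adm' -[in LHS](prednK l_gt0) exprS mulN1r mulrNN mulrCA.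
by congr (_ * (_ * _)).
Qed.

(** The coefficient 1/2 of [H] is doubled in the first step, where
    [1 + (-1)^0 = 2], and afterwards the leading coefficient is unchanged. *)
Lemma Scoef_leading (n : nat) : Scoef n.+1 0 n.+1%:Z [::] = 1.
Proof.
have adm m : admissible m 0 m%:Z [::] by apply/and5P; split=> //; lia.
elim: n => [|n IHn]; rewrite ScoefS // big_nil addr0 /=.
  by rewrite /Scoef adm /= seq_mset_nil mcoeffUU.
by rewrite IHn mulr1.
Qed.

Theorem proposition8p3 :
  (forall (n l d : nat) (ns : seq nat), admissible n.+1 l d%:Z ns ->
     (d = 1%N ->
        Scoef n.+1 l d%:Z ns =
          (1 + (-1) ^+ n) * Scoef n l (d%:Z - 1) ns
          + \sum_(k <- undup ns)
              'C(d + k, k)%:R * Scoef n l.-1 (d + k + 1)%N%:Z (rem k ns))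
     /\
     (d <> 1%N ->
        Scoef n.+1 l d%:Z ns =
          Scoef n l (d%:Z - 1) ns
          + \sum_(k <- undup ns)
              'C(d + k, k)%:R * Scoef n l.-1 (d + k + 1)%N%:Z (rem k ns)))
  /\ Scoef 0 0 0 [::] = 1 / 2
  /\ (forall n : nat, (1 <= n)%N -> Scoef n 0 n%:Z [::] = 1).
Proof.
split; last first.
  split; last by case=> // n _; exact: Scoef_leading.
  by rewrite /Scoef /= seq_mset_nil mcoeffUU expr0 mul1r.
move=> n l d ns /ScoefS ->.
have predZ d' : d'.+1%:Z - 1 = d'%:Z by lia.
split; first by move=> ->; rewrite predZ.
case: d => [|[|d]] // _; last by rewrite predZ /= mul1r.
by rewrite [Scoef n l _ ns]/Scoef /admissible !andbF.
Qed.
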